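(* Let $f:\mathbb{R}^n\to\mathbb{R}$ be a convex continuous function. Then, for every $x_0\in\mathbb{R}^n$, the trajectory $\gamma$ of the subgradient system $$\dot\gamma(t)\in-\partial f(\gamma(t))\ \text{ for a.e. } t\in[0,+\infty),\qquad \gamma(0)=x_0,$$ is a self-contracted curve.
   Context: For a convex function $f:\mathbb{R}^n\to\mathbb{R}$, $\partial f(x)=\{p\in\mathbb{R}^n : f(y)\ge f(x)+\langle p,y-x\rangle\ \text{for all } y\in\mathbb{R}^n\}$. The subgradient system has a unique absolutely continuous solution $\gamma:[0,+\infty)\to\mathbb{R}^n$, which is called its trajectory (the derivative $\dot\gamma$ exists almost everywhere and $\gamma(t_2)=\gamma(t_1)+\int_{t_1}^{t_2}\dot\gamma(t)\,dt$ for all $0\le t_1\le t_2$). A curve $\gamma:I\to\mathbb{R}^n$ defined on an interval $I$ of $[0,+\infty)$ is called self-contracted if for all $t_1\le t_2\le t_3$ in $I$ one has $\mathrm{dist}(\gamma(t_1),\gamma(t_3))\ge\mathrm{dist}(\gamma(t_2),\gamma(t_3))$, where $\mathrm{dist}$ is the Euclidean distance. *)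

(* Defs.v *)
From mathcomp Require Import all_boot all_order all_algebra.
From mathcomp Require Import all_classical all_reals all_analysis.

Set Implicit Arguments.
Unset Strict Implicit.
Unset Printing Implicit Defensive.

Import Order.TTheory GRing.Theory Num.Theory.
Import numFieldNormedType.Exports.

Local Open Scope classical_set_scope.
Local Open Scope ring_scope.

(* The library norm on ['rV[R]_n] is the sup norm: it induces the usual topology
   (hence the usual continuity and derivative), but not the Euclidean distance. *)
Definition dotp (R : realType) (n : nat) (u v : 'rV[R]_n) : R :=
  \sum_(i < n) u 0 i * v 0 i.

Definition edist (R : realType) (n : nat) (x y : 'rV[R]_n) : R :=
  Num.sqrt (dotp (x - y) (x - y)).

Definition subdifferential (R : realType) (n : nat) (f : 'rV[R]_n -> R)
    (x : 'rV[R]_n) : set 'rV[R]_n :=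
  [set p | forall y : 'rV[R]_n, f x + dotp p (y - x) <= f y].

(* Curves [0, +oo) -> R^n are represented by total functions on R whose values
   at negative times are irrelevant: they can only affect the derivative at
   t = 0, a null set.
   [Rintegral] is total, so integrability of the derivative, implicit in the
   formula gamma(t2) = gamma(t1) + \int gamma', is required explicitly. *)
Definition absolutely_continuous (R : realType) (n : nat)
    (gamma : R -> 'rV[R]_n) : Prop :=
  {ae (@lebesgue_measure R), forall t : R, 0 <= t -> derivable gamma t 1} /\
  forall t1 t2 : R, 0 <= t1 -> t1 <= t2 ->
    (forall i : 'I_n, (@lebesgue_measure R).-integrable `[t1, t2]
       (fun t : R => (derive1 gamma t 0 i)%:E)) /\
    gamma t2 = gamma t1 +
      \row_(i < n) (\int[@lebesgue_measure R]_(t in `[t1, t2]) derive1 gamma t 0 i).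

Definition trajectory (R : realType) (n : nat) (f : 'rV[R]_n -> R)
    (x0 : 'rV[R]_n) (gamma : R -> 'rV[R]_n) : Prop :=
  [/\ absolutely_continuous gamma,
      {ae (@lebesgue_measure R), forall t : R, 0 <= t ->
        [set - p | p in subdifferential f (gamma t)] (derive1 gamma t)} &
      gamma 0 = x0].

Definition self_contracted (R : realType) (n : nat) (I : interval R)
    (gamma : R -> 'rV[R]_n) : Prop :=
  forall t1 t2 t3 : R, t1 \in I -> t2 \in I -> t3 \in I ->
    t1 <= t2 -> t2 <= t3 ->
    edist (gamma t2) (gamma t3) <= edist (gamma t1) (gamma t3).

(* Main.v *)
Require Import Defs.
From mathcomp Require Import all_boot all_order all_algebra.
From mathcomp Require Import all_classical all_reals all_analysis.
From mathcomp Require Import measurable_realfun ring lra.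
Import Order.TTheory GRing.Theory Num.Theory.
Import numFieldNormedType.Exports.
Local Open Scope classical_set_scope.
Local Open Scope ring_scope.

(** The squared distance from the curve to a point [y] has derivative
    [2 <gamma', gamma - y>] almost everywhere, and since [- gamma'(t)] is a
    subgradient of [f] at [gamma t], this is at most [2 (f y - f (gamma t))].
    Hence the curve does not move away from [y] on any time interval on which
    [f o gamma] stays above [f y] ([trajectory_edist_le]).  Both halves of the
    proof are instances of this fact.

    With [y := gamma s], where [s] minimizes [f o gamma] over [[a, b]], it gives
    [dist (gamma b) (gamma s) <= dist (gamma s) (gamma s) = 0], so the minimum
    is attained at [b]: [f o gamma] is nonincreasing ([trajectory_decreasing]).
    With [y := gamma t3], the monotonicity just obtained is the required
    hypothesis on [[t1, t2]], and the conclusion is self-contractedness.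

    Passing from the derivative of the squared distance to the squared distance
    itself requires the fundamental theorem of calculus for the square of an
    indefinite integral of an integrable function [g] that may be discontinuous
    ([sqr_indefinite_integral]).  It is obtained without differentiation: on a
    short interval [x(t)^2 - x(s)^2 = (x t + x s) * \int g] differs from
    [2 \int g x] by at most [e \int |g|], and such estimates add up over
    adjacent intervals ([additive_interval_ind]). *)

(* As opposed to the extended-real distance of a pseudometric space, which has
   the same short name. *)
Local Notation edist := Defs.edist.

(** * Passing from small intervals to an interval *)

(** Compactness of [[a, b]], in a form that avoids choosing a fine subdivision:
    the supremum [c] of the times [t] for which [P a t] holds can be reached,
    and crossed unless [c = b], by an interval around [c]. *)
Lemma additive_interval_ind (R : realType) (P : R -> R -> Prop) (a b : R) :
  a <= b ->
  (forall s m t, a <= s -> s <= m -> m <= t -> t <= b ->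
     P s m -> P m t -> P s t) ->
  (forall c, a <= c <= b -> exists2 d : R, 0 < d &
     forall s t, a <= s -> s <= c -> c <= t -> t <= b ->
       c - d < s -> t < c + d -> P s t) ->
  P a b.
Proof.
move=> ab Pcat Ploc.
pose S := [set t | a <= t <= b /\ P a t].
have Sa : S a.
  split; first by rewrite lexx.
  have [|d d0 Pd] := Ploc a; first by rewrite lexx.
  by apply: Pd; lra.
have ubS : ubound S b by move=> t [/andP[]].
have supS : has_sup S by split; [exists a | exists b].
have ac : a <= sup S by apply: ub_le_sup => //; exists b.
have cb : sup S <= b by apply: ge_sup => //; exists a.
have [|d d0 Pd] := Ploc (sup S); first by rewrite ac cb.
have [s [/andP[as_ sb] Pas] cds] := sup_adherent d0 supS.
have sc : s <= sup S by apply: ub_le_sup; [exists b | split; rewrite ?as_].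
pose t := Num.min b (sup S + d / 2).
have tb : t <= b by rewrite ge_min lexx.
have td : t <= sup S + d / 2 by rewrite ge_min lexx orbT.
have ct : sup S <= t by rewrite le_min cb/=; lra.
have Pat : P a t.
  by apply: (Pcat a s t) => //; [lra|apply: Pd => //; lra].
have St : S t by split => //; rewrite tb andbT; lra.
have tc : t <= sup S by apply: ub_le_sup => //; exists b.
suff <- : t = b by [].
move: tc; rewrite /t; case: (leP b) => [//|_ tc]; exfalso; lra.
Qed.

(** * Indefinite integrals *)

Section indefinite_integral.
Context {R : realType}.
Notation mu := (@lebesgue_measure R).
Implicit Types (x g h : R -> R) (a b c : R).

Lemma integrable_subitv {g a b} (s t : R) : a <= s -> t <= b ->
  mu.-integrable `[a, b] (EFin \o g) -> mu.-integrable `[s, t] (EFin \o g).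
Proof.
move=> as_ tb; apply: integrableS => //.
by apply: subset_itv; rewrite bnd_simp.
Qed.

Lemma Rintegral_itv_cat g a c b : a <= c -> c <= b ->
  mu.-integrable `[a, b] (EFin \o g) ->
  \int[mu]_(t in `[a, b]) g t =
    \int[mu]_(t in `[a, c]) g t + \int[mu]_(t in `[c, b]) g t.
Proof.
move=> ac cb ig.
have := @Rintegral_itvB R g (BLeft a) (BRight b) c ig.
rewrite !bnd_simp => /(_ ac cb) Eq.
rewrite -(@Rintegral_itv_obnd_cbnd R c) -?Eq; first by ring.
apply: integrableS ig => //.
by apply: subset_itv; rewrite bnd_simp.
Qed.

Lemma integrable_scale k {g a b} : mu.-integrable `[a, b] (EFin \o g) ->
  mu.-integrable `[a, b] (EFin \o (fun u => k * g u)).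
Proof. by move=> ig; have := integrableZl _ k ig; apply. Qed.

(** On [[a, b]], this says that [x] is absolutely continuous, with [g] for
    derivative. *)
Definition indefinite_integral x g a b :=
  mu.-integrable `[a, b] (EFin \o g) /\
  forall s t, a <= s -> s <= t -> t <= b ->
    x t = x s + \int[mu]_(u in `[s, t]) g u.

Lemma indefinite_integral_continuous {x g a b} : a <= b ->
  indefinite_integral x g a b -> {within `[a, b], continuous x}.
Proof.
move=> ab [ig xE].
have cI := parameterized_integral_continuous ab ig.
apply: (@subspace_eq_continuous _ _ _
  (fun t => x a + parameterized_integral mu a t g)).
  by move=> t /set_mem /=; rewrite in_itv/= => /andP[at_ tb]; rewrite -xE.
move=> t; apply: cvgD; first exact: cvg_cst.
exact: cI.
Qed.

Lemma integrable_mul_continuous {g h a b} :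
  mu.-integrable `[a, b] (EFin \o g) -> {within `[a, b], continuous h} ->
  mu.-integrable `[a, b] (EFin \o (fun t => g t * h t)).
Proof.
move=> ig ch.
apply: (@integrableMl _ _ _ mu _ _ (EFin \o g) h) => //.
  exact: subspace_continuous_measurable_fun.
have /compact_bounded : compact (h @` `[a, b]).
  by apply: continuous_compact => //; exact: segment_compact.
move=> [M [Mr hM]]; exists M; split=> // N MN t tab.
by apply: (hM N MN); exists t.
Qed.

(** With [E s t] the defect of the formula on [[s, t]],
    [E s t = \int_s^t g(u) ((x t - x u) + (x s - x u)) du], so near any point
    the continuity of [x] bounds it by [e \int_s^t |g|].  As both sides of this
    bound are additive, it extends to [[a, b]], where [e] is arbitrary. *)
Lemma sqr_indefinite_integral {x g a b} : a <= b ->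
  indefinite_integral x g a b ->
  x b ^+ 2 - x a ^+ 2 = 2 * \int[mu]_(t in `[a, b]) (g t * x t).
Proof.
move=> ab xg; have [ig xE] := xg.
have cx := indefinite_integral_continuous ab xg.
have igx := integrable_mul_continuous ig cx.
pose E s t := x t ^+ 2 - x s ^+ 2 - 2 * \int[mu]_(u in `[s, t]) (g u * x u).
pose G s t := \int[mu]_(u in `[s, t]) `|g u|.
have ing : mu.-integrable `[a, b] (EFin \o (fun u => `|g u|)).
  exact: integrable_norm ig.
suff bound (e : R) : 0 < e -> `|E a b| <= e * G a b.
  apply/eqP; rewrite -subr_eq0 -normr_le0 -/(E a b); apply/ler_addgt0Pl => e e0.
  have G0 : 0 <= G a b by apply: Rintegral_ge0 => u _.
  have G1 : 0 < G a b + 1 by lra.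
  rewrite addr0; apply: le_trans (bound (e / (G a b + 1)) _) _.
    exact: divr_gt0.
  by rewrite -mulrA ger_pMr// mulrC ler_pdivrMr//; lra.
move=> e0.
apply: (@additive_interval_ind R (fun s t => `|E s t| <= e * G s t)) => //.
  move=> s m t as_ sm mt tb Esm Emt.
  have -> : E s t = E s m + E m t.
    rewrite /E (Rintegral_itv_cat _ s m t)//; first by ring.
    exact: integrable_subitv igx.
  rewrite /G (Rintegral_itv_cat _ s m t)//; last exact: integrable_subitv ing.
  rewrite mulrDr; apply: le_trans (ler_normD _ _) _; exact: lerD.
move=> c /andP[ac cb].
(* The bracket [(x t - x u) + (x s - x u)] is a sum of four increments of [x]
   from [c], each of which gets a quarter of [e]. *)
have [d d0 xd] : exists2 d : R, 0 < d & forall u, a <= u -> u <= b ->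
    `|c - u| < d -> `|x c - x u| < e / 4.
  have cab : `[a, b]%classic c by rewrite /= in_itv/= ac cb.
  move/subspace_continuousP : cx => /(_ c cab) /cvgrPdist_lt /(_ (e / 4)).
  rewrite divr_gt0// => /(_ isT); rewrite near_withinE => -[d /= d0 xd].
  exists d => // u au ub cu; apply: xd => //.
  by rewrite /= in_itv/= au ub.
exists d => // s t as_ sc ct tb ds td.
have st : s <= t by lra.
have isub := integrable_subitv s t as_ tb.
have igst := isub _ ig; have igxst := isub _ igx; have ingst := isub _ ing.
have ig2 : mu.-integrable `[s, t] (EFin \o (fun u => 2 * (g u * x u))).
  exact: integrable_scale igxst.
have igE : mu.-integrable `[s, t]
    (EFin \o (fun u => (x t + x s) * g u - 2 * (g u * x u))).
  exact: (integrableB _ (integrable_scale (x t + x s) igst) ig2).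
have -> : E s t =
    \int[mu]_(u in `[s, t]) ((x t + x s) * g u - 2 * (g u * x u)).
  rewrite RintegralB//; last exact: integrable_scale igst.
  rewrite !RintegralZl// /E (xE s t)//; ring.
apply: le_trans (le_normr_Rintegral _ _) _ => //.
rewrite /G -RintegralZl//; apply: le_Rintegral => //.
- exact: integrable_norm.
- exact: integrable_scale ingst.
move=> u /=; rewrite in_itv/= => /andP[su ut].
have -> : (x t + x s) * g u - 2 * (g u * x u) =
  g u * ((x t - x u) + (x s - x u)) by ring.
rewrite normrM mulrC ler_wpM2r//.
have near_c v : s <= v -> v <= t -> `|x c - x v| < e / 4.
  move=> sv vt; apply: xd; [lra|lra|].
  by rewrite ltr_norml; apply/andP; split; lra.
have := near_c _ (lexx s) st; have := near_c _ st (lexx t).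
have := near_c _ su ut.
rewrite !ltr_norml => /andP[? ?] /andP[? ?] /andP[? ?].
by rewrite ler_norml; apply/andP; split; lra.
Qed.

Lemma Rintegral_sum (I : Type) (r : seq I) (F : I -> R -> R) (a b : R) :
  (forall i, mu.-integrable `[a, b] (EFin \o F i)) ->
  \int[mu]_(t in `[a, b]) (\sum_(i <- r) F i t) =
    \sum_(i <- r) \int[mu]_(t in `[a, b]) F i t.
Proof.
move=> iF; rewrite /Rintegral.
under eq_integral do rewrite -sumEFin.
rewrite integral_sum// sum_fine// => i _.
by have := integrable_fin_num _ (iF i); apply.
Qed.

Lemma integrable_Rsum (I : Type) (r : seq I) (F : I -> R -> R) (a b : R) :
  (forall i, mu.-integrable `[a, b] (EFin \o F i)) ->
  mu.-integrable `[a, b] (EFin \o (fun t => \sum_(i <- r) F i t)).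
Proof.
move=> iF; rewrite (_ : _ \o _ = (fun t => \sum_(i <- r) (EFin \o F i) t)%E).
  exact: integrable_sum.
by apply/funext => t; rewrite /= sumEFin.
Qed.

Lemma lebesgue_aeS {P Q : R -> Prop} : (forall t, P t -> Q t) ->
  {ae mu, forall t, P t} -> {ae mu, forall t, Q t}.
Proof.
have FF : Filter (almost_everywhere mu) := ae_filter_ringOfSetsType mu.
exact: (@filterS _ _ FF).
Qed.

Lemma Rintegral_le0_ae (f : R -> R) (a b : R) :
  mu.-integrable `[a, b] (EFin \o f) ->
  {ae mu, forall t, a <= t <= b -> f t <= 0} ->
  \int[mu]_(t in `[a, b]) f t <= 0.
Proof.
move=> intf f0; rewrite /Rintegral fine_le0// integralE.
have mf := measurable_int _ intf.
rewrite (_ : \int[mu]_(x in `[a, b]) (fun t => (f t)%:E)^\+ x = 0)%E; last first.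
  transitivity (\int[mu]_(x in `[a, b]) cst 0 x)%E; last exact: integral0.
  apply: ae_eq_integral => //; first exact: measurable_funepos.
  suff: {ae mu, forall t, `[a, b]%classic t ->
      (EFin \o f)^\+%E t = cst 0%E t} by [].
  apply: (lebesgue_aeS _ f0) => t ft0 /=; rewrite in_itv/= => tab.
  by rewrite funeposE; apply/max_idPr; rewrite lee_fin ft0.
by rewrite sub0e oppe_le0; apply: integral_ge0 => t _; exact: funeneg_ge0.
Qed.

End indefinite_integral.

(** * Curves in Euclidean space *)

Section curves.
Context {R : realType} {n : nat}.
Notation mu := (@lebesgue_measure R).
Implicit Types (gamma v : R -> 'rV[R]_n) (y : 'rV[R]_n) (a b : R).

Lemma rV_within_continuous gamma (A : set R) :
  (forall i, {within A, continuous (fun t => gamma t 0 i)}) ->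
  {within A, continuous gamma}.
Proof.
move=> cg t; apply/cvg_ballP => e e0.
have H i : \forall s \near (t : subspace A), ball (gamma t 0 i) e (gamma s 0 i).
  by have /cvg_ballP := cg i t; exact.
near=> s; split=> // i j; rewrite (ord1 i).
move: j; near: s; exact: filter_forall.
Unshelve. all: by end_near.
Qed.

Lemma edist_le0_eq (x y : 'rV[R]_n) : edist x y <= 0 -> x = y.
Proof.
rewrite leNgt sqrtr_gt0 -leNgt => le0.
have sq_ge0 (i : 'I_n) : xpredT i -> 0 <= (x - y) 0 i * (x - y) 0 i.
  by move=> _; rewrite -expr2 sqr_ge0.
have /eqP : dotp (x - y) (x - y) = 0.
  by apply/eqP; rewrite eq_le le0 sumr_ge0.
rewrite psumr_eq0// => /allP sq0; apply/rowP => i; apply/eqP.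
by have := sq0 i (mem_index_enum i); rewrite !mxE mulf_eq0 orbb subr_eq0.
Qed.

(** [2 <v, gamma - y>] is the derivative of the squared distance to [y], and
    [sqr_indefinite_integral], applied to each coordinate of [gamma - y], makes
    the squared distance its integral. *)
Lemma edist_le_of_dotp_le0 gamma v y a b : a <= b ->
  (forall i, indefinite_integral (fun t => gamma t 0 i) (fun t => v t 0 i) a b) ->
  {ae mu, forall t, a <= t <= b -> dotp (v t) (gamma t - y) <= 0} ->
  edist (gamma b) y <= edist (gamma a) y.
Proof.
move=> ab gv le0.
pose x i t := gamma t 0 i - y 0 i.
have xv i : indefinite_integral (x i) (fun t => v t 0 i) a b.
  have [iv gE] := gv i; split=> // s t as_ st tb.
  by rewrite /x (gE s t)//; ring.
have ixv i : mu.-integrable `[a, b] (EFin \o (fun t => v t 0 i * x i t)).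
  have := indefinite_integral_continuous ab (xv i).
  by apply: integrable_mul_continuous; case: (xv i).
rewrite /edist ler_wsqrtr// -subr_le0.
have dotpE t : dotp (gamma t - y) (gamma t - y) = \sum_i x i t ^+ 2.
  by apply: eq_bigr => i _; rewrite !mxE expr2.
rewrite !dotpE -sumrB.
under eq_bigr do rewrite (sqr_indefinite_integral ab (xv _)).
rewrite -mulr_sumr -Rintegral_sum// pmulr_rle0//.
apply: Rintegral_le0_ae.
  exact: integrable_Rsum.
apply: (lebesgue_aeS _ le0) => t let0 /let0; congr (_ <= _).
by apply: eq_bigr => i _; rewrite !mxE.
Qed.

End curves.

(** * Trajectories of the subgradient system *)

Section trajectories.
Context {R : realType} {n : nat}.
Implicit Types (f : 'rV[R]_n -> R) (gamma : R -> 'rV[R]_n).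
Implicit Types (y : 'rV[R]_n) (a b : R).

Lemma trajectory_indefinite_integral {f x0 gamma a b} :
  trajectory f x0 gamma -> 0 <= a -> a <= b -> forall i,
  indefinite_integral (fun t => gamma t 0 i) (fun t => derive1 gamma t 0 i) a b.
Proof.
move=> [[_ gammaE] _ _] a0 ab i; split; first exact: (gammaE a b a0 ab).1.
move=> s t as_ st tb; have [_ ->] := gammaE s t (le_trans a0 as_) st.
by rewrite !mxE.
Qed.

(** The subgradient inequality at [gamma t], tested against [y], bounds
    [<gamma' t, gamma t - y>] by [f y - f (gamma t)]. *)
Lemma trajectory_edist_le {f x0 gamma} y {a b} :
  trajectory f x0 gamma -> 0 <= a -> a <= b ->
  (forall t, a <= t -> t <= b -> f y <= f (gamma t)) ->
  edist (gamma b) y <= edist (gamma a) y.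
Proof.
move=> traj a0 ab fy; have [_ gamma_subgrad _] := traj.
apply: (edist_le_of_dotp_le0 gamma (derive1 gamma)) => //.
  exact: trajectory_indefinite_integral traj _ _.
apply: (lebesgue_aeS _ gamma_subgrad) => t sub /andP[at_ tb].
have [p /(_ y) py <-] := sub (le_trans a0 at_).
have -> : dotp (- p) (gamma t - y) = dotp p (y - gamma t).
  by apply: eq_bigr => i _; rewrite !mxE; ring.
by have := fy t at_ tb; lra.
Qed.

(** The curve cannot leave the point [gamma s] where [f o gamma] is minimal on
    [[a, b]]: after the time [s], the distance to that point does not grow from
    its initial value [0]. *)
Lemma trajectory_decreasing {f x0 gamma a b} :
  continuous f -> trajectory f x0 gamma -> 0 <= a -> a <= b ->
  f (gamma b) <= f (gamma a).
Proof.
move=> cf traj a0 ab.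
have cg : {within `[a, b], continuous gamma}.
  apply: rV_within_continuous => i.
  exact: indefinite_integral_continuous
    (trajectory_indefinite_integral traj a0 ab i).
have cfg : {within `[a, b], continuous (f \o gamma)}.
  by move=> t; apply: cvg_comp; [exact: cg|exact: cf].
have [s] := EVT_min ab cfg.
rewrite in_itv/= => /andP[as_ sb] smin.
have : edist (gamma b) (gamma s) <= edist (gamma s) (gamma s).
  apply: (trajectory_edist_le _ traj) => // [|t st tb]; first exact: le_trans as_.
  by apply: smin; rewrite in_itv/= tb andbT; exact: le_trans st.
have -> : edist (gamma s) (gamma s) = 0.
  rewrite /edist subrr /dotp big1 ?sqrtr0// => i _.
  by rewrite mxE mul0r.
move=> /edist_le0_eq ->.
by apply: smin; rewrite in_itv/= lexx.
Qed.

End trajectories.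

Theorem proposition6p4 (R : realType) (n : nat) (f : 'rV[R]_n -> R)
    (f_convex : convex_function [set: 'rV[R]_n] f)
    (f_continuous : continuous f)
    (x0 : 'rV[R]_n) (gamma : R -> 'rV[R]_n)
    (gamma_trajectory : trajectory f x0 gamma) :
  self_contracted `[0, +oo[ gamma.
Proof.
move=> t1 t2 t3; rewrite !in_itv/= !andbT => t10 t20 t30 t12 t23.
apply: (trajectory_edist_le _ gamma_trajectory) => // t t1t tt2.
apply: (trajectory_decreasing f_continuous gamma_trajectory) => //.
  exact: le_trans t1t.
exact: le_trans t23.
Qed.
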